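(* Let $0<q<p$ be real numbers and let $\{f_n(x)\}_{n=0}^{\infty}$ be a sequence of polynomials such that $f_n(x)$ has exact degree $n$ for every $n\ge 0$. Then the following are equivalent: 1. $\{f_n(x)\}_{n=0}^{\infty}$ is a $(p,q)$-Appell polynomial sequence, i.e. $D_{p,q}f_{n+1}(x)=[n+1]_{p,q}f_n(px)$ for all $n\ge 0$. 2. There exists a sequence $(a_k)_{k\ge 0}$, independent of $n$, with $a_0\neq 0$, such that for all $n\ge 0$ $$f_n(x)=\sum_{k=0}^{n}\begin{bmatrix} n\\ k\end{bmatrix}_{p,q}p^{\binom{n-k}{2}}a_k x^{n-k}.$$ 3. $\{f_n(x)\}_{n=0}^{\infty}$ is generated by $$A(t)\,e_{p,q}(xt)=\sum_{n=0}^{\infty}f_n(x)\frac{t^n}{[n]_{p,q}!}$$ for some determining function $A(t)=\sum_{n=0}^{\infty}a_n\frac{t^n}{[n]_{p,q}!}$ (as formal power series in $t$). 4. There exists a sequence $(a_k)_{k\ge 0}$, independent of $n$, with $a_0\neq 0$, such that for all $n\ge 0$ $$f_n(x)=\left(\sum_{k=0}^{\infty}\frac{a_k\,p^{\binom{n-k}{2}}}{[k]_{p,q}!}D_{p,q}^{k}\right)x^n.$$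
   Context: Polynomials have complex coefficients. Notation: $[n]_{p,q}=\frac{p^n-q^n}{p-q}$; $[0]_{p,q}!=1$ and $[n]_{p,q}!=\prod_{k=1}^n[k]_{p,q}$; $\begin{bmatrix} n\\ k\end{bmatrix}_{p,q}=\frac{[n]_{p,q}!}{[k]_{p,q}!\,[n-k]_{p,q}!}$ for $0\le k\le n$; $\binom{m}{2}=\frac{m(m-1)}{2}$. The $(p,q)$-derivative is $D_{p,q}f(x)=\frac{f(px)-f(qx)}{(p-q)x}$ for $x\ne 0$, $(D_{p,q}f)(0)=f'(0)$ (so $D_{p,q}x^n=[n]_{p,q}x^{n-1}$), and $D_{p,q}^k$ is its $k$-th iterate. In item 4 the sum is effectively finite because $D_{p,q}^kx^n=0$ for $k>n$. The $(p,q)$-exponential is $e_{p,q}(z)=\sum_{n=0}^{\infty}\frac{p^{\binom n2}}{[n]_{p,q}!}z^n$. *)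

(* Defs.v *)
From HB Require Import structures.
From mathcomp Require Import all_boot all_order all_algebra.
From mathcomp Require Import all_classical all_reals.
From mathcomp Require Import topology normedtype derive.
From mathcomp.real_closed Require Import complex.

Set Implicit Arguments.
Unset Strict Implicit.
Unset Printing Implicit Defensive.

Import Order.TTheory GRing.Theory Num.Theory.
Import numFieldNormedType.Exports.

Local Open Scope classical_set_scope.
Local Open Scope ring_scope.

Section PQNumbers.
Variables (K : fieldType) (p q : K).

Definition pqnat (n : nat) : K := (p ^+ n - q ^+ n) / (p - q).

Definition pqfact (n : nat) : K := \prod_(1 <= k < n.+1) pqnat k.

(* Only meaningful for k <= n, because n - k is truncated. *)
Definition pqbinom (n k : nat) : K := pqfact n / (pqfact k * pqfact (n - k)).

(* Coefficients of e_{p,q}(z) = \sum_n p^(n choose 2) / [n]! z^n. *)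
Definition pqexp (n : nat) : K := p ^+ 'C(n, 2) / pqfact n.

(* Coefficients of the formal series \sum_n u_n t^n / [n]!. *)
Definition pqgen (V : lmodType K) (u : nat -> V) (n : nat) : V :=
  (pqfact n)^-1 *: u n.

End PQNumbers.

(* The integer m(m-1)/2; the division is exact, and m may be negative. *)
Definition binom2z (m : int) : int := (m * (m - 1) %/ 2)%Z.

(* A formal power series in t over A is its coefficient sequence nat -> A. *)
Definition fps_mul (A : pzRingType) (u v : nat -> A) (n : nat) : A :=
  \sum_(k < n.+1) u k * v (n - k)%N.

(* Coefficients in t of the series e(xt), x being the polynomial variable. *)
Definition fps_xt (K : nzRingType) (e : nat -> K) (n : nat) : {poly K} :=
  e n *: 'X^n.

(* f^`() is the derivative of f : K -> K as a limit of difference quotients in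
   the norm topology of K: the complex derivative when K = R[i]. *)
Definition pqderiv (K : numFieldType) (p q : K) (f : K -> K) (x : K) : K :=
  if x == 0 then f^`()%classic 0 else (f (p * x) - f (q * x)) / ((p - q) * x).

Definition pqAppell (K : numFieldType) (p q : K) (f : nat -> {poly K}) : Prop :=
  forall (n : nat) (x : K),
    pqderiv p q (horner (f n.+1)) x = pqnat p q n.+1 * (f n).[p * x].

(* Main.v *)
(** Every item is a description of the same family: writing [c n j] for the
    coefficient of [x^j] in [f n], the Appell relation reads
    [[j+1] c(n+1, j+1) = [n+1] p^j c(n, j)], and unfolding it down to [j = 0]
    gives item 2 with [a n = c(n, 0)].  Items 3 and 4 are item 2 rewritten, using
    [D^k x^n = [n]!/[n-k]! x^(n-k)] for the latter.  Pointwise identities become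
    polynomial identities because a numeric field is infinite. *)
Require Import Defs.
From HB Require Import structures.
From mathcomp Require Import all_boot all_order all_algebra.
From mathcomp Require Import all_classical all_reals.
From mathcomp Require Import topology normedtype derive.
From mathcomp.real_closed Require Import complex.
From mathcomp Require Import ring.

Import Order.TTheory GRing.Theory Num.Theory.
Import numFieldNormedType.Exports.

Local Open Scope classical_set_scope.
Local Open Scope complex_scope.
Local Open Scope ring_scope.

Lemma poly_ext (K : numDomainType) (f g : {poly K}) : horner f =1 horner g -> f = g.
Proof.
move=> fg; apply/eqP; rewrite -subr_eq0; apply/eqP.
(* Naturals stay distinct in characteristic zero, so these are as many roots of [f - g] as its size,
   one more than a nonzero polynomial admits. *)
pose rs := [seq n%:R : K | n <- iota 0 (size (f - g))].
apply: (@roots_geq_poly_eq0 _ _ rs).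
- by apply/allP => x _; rewrite /root !hornerE fg subrr.
- rewrite map_inj_uniq ?iota_uniq // => m n /eqP.
  by rewrite eqr_nat => /eqP.
- by rewrite size_map size_iota.
Qed.

Lemma coef_comp_scaleX (K : comNzRingType) (f : {poly K}) (c : K) i :
  (f \Po (c *: 'X))`_i = c ^+ i * f`_i.
Proof.
rewrite comp_polyE.
under eq_bigr do rewrite exprZn scalerA.
rewrite -(poly_def _ (fun i => f`_i * c ^+ i)) coef_poly.
by case: ltnP => [_|/(nth_default 0) ->]; rewrite ?mulr0 // mulrC.
Qed.

Lemma is_derive_horner (K : numFieldType) (f : {poly K}) (x : K) :
  is_derive x (1 : K) (horner f) f^`().[x].
Proof.
elim/poly_ind: f => [|f c IH].
  have -> : horner (0 : {poly K}) = cst 0 by apply/funext => y; rewrite horner0.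
  by rewrite deriv0 horner0; exact: is_derive_cst.
have -> : horner (f * 'X + c%:P) = horner f * id + cst c.
  by apply/funext => y; rewrite !hornerE.
apply: is_derive_eq.
rewrite derivD derivM derivX derivC !hornerE /= /GRing.scale /=; ring.
Qed.

Lemma binom2z_nat (m : nat) : binom2z m = 'C(m, 2).
Proof.
case: m => [|m] //; rewrite /binom2z bin2 -divn2 -divz_nat /=.
by rewrite -predn_int.
Qed.

Section PQCalculus.
Variables (K : numFieldType) (p q : K).
Hypothesis pNq : p != q.
Hypothesis pqnat_neq0 : forall n, pqnat p q n.+1 != 0.

Let pBq_neq0 : p - q != 0. Proof. by rewrite subr_eq0. Qed.

Lemma pqnat0 : pqnat p q 0 = 0.
Proof. by rewrite /pqnat subrr mul0r. Qed.

Lemma pqnat1 : pqnat p q 1 = 1.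
Proof. by rewrite /pqnat !expr1 divff. Qed.

Lemma pqfact0 : pqfact p q 0 = 1.
Proof. by rewrite /pqfact big_nil. Qed.

Lemma pqfactS n : pqfact p q n.+1 = pqfact p q n * pqnat p q n.+1.
Proof. by rewrite /pqfact big_nat_recr. Qed.

Lemma pqfact_neq0 n : pqfact p q n != 0.
Proof. by elim: n => [|n IH]; rewrite ?pqfact0 ?oner_neq0 // pqfactS mulf_neq0. Qed.

(** The formal counterpart of [pqderiv]: acting on coefficients, it involves neither a quotient by x
    nor a limit at 0. *)
Definition pqder (f : {poly K}) : {poly K} :=
  \poly_(i < (size f).-1) (pqnat p q i.+1 * f`_i.+1).

Lemma coef_pqder f i : (pqder f)`_i = pqnat p q i.+1 * f`_i.+1.
Proof.
rewrite coef_poly; case: ltnP => // le_i.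
by rewrite nth_default ?mulr0 // -ltnS; case: (size f) le_i.
Qed.

(** Clearing the denominator of the difference quotient leaves a polynomial identity, which can be
    checked coefficient by coefficient. *)
Lemma pqderMX f :
  pqder f * ((p - q) *: 'X) = (f \Po (p *: 'X)) - (f \Po (q *: 'X)).
Proof.
apply/polyP => i; rewrite -scalerAr coefZ coefMX coefB !coef_comp_scaleX.
case: i => [|i] /=; first by rewrite !expr0 subrr mulr0.
by rewrite coef_pqder /pqnat; field.
Qed.

Lemma pqderiv_horner f : pqderiv p q (horner f) = horner (pqder f).
Proof.
apply/funext => x; rewrite /pqderiv; case: eqVneq => [->|x0].
  (* At 0 both derivatives give the linear coefficient of [f], because [1] = 1. *)
  rewrite derive1E (@derive_val _ _ _ _ _ _ _ (is_derive_horner _ f 0)).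
  by rewrite !horner_coef0 coef_pqder coef_deriv pqnat1 mul1r mulr1n.
have := congr1 (horner^~ x) (pqderMX f).
rewrite hornerM hornerD hornerN !horner_comp !hornerZ hornerX => <-.
by rewrite mulfK // mulf_neq0.
Qed.

Lemma pqderXn n : pqder 'X^n = pqnat p q n *: 'X^(n.-1).
Proof.
apply/polyP => i; rewrite coef_pqder coefZ !coefXn.
case: n => [|n] /=; first by rewrite pqnat0 mulr0 mul0r.
by rewrite eqSS; case: eqVneq => [->|]; rewrite ?mulr0.
Qed.

Lemma pqderZ c f : pqder (c *: f) = c *: pqder f.
Proof. by apply/polyP => i; rewrite !(coefZ, coef_pqder) mulrCA. Qed.

Lemma iter_pqderXn n k : (k <= n)%N ->
  iter k pqder 'X^n = (pqfact p q n / pqfact p q (n - k)) *: 'X^(n - k).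
Proof.
elim: k => [|k IH] lt_kn; first by rewrite subn0 divff ?pqfact_neq0 // scale1r.
rewrite iterS IH 1?ltnW // pqderZ pqderXn scalerA -(subnSK lt_kn) pqfactS /=.
by congr (_ *: _); field; rewrite pqnat_neq0 pqfact_neq0.
Qed.

(** The n-th iterate of x^n is a constant, which the next application kills since [0] = 0. *)
Lemma iter_pqderXn_eq0 n k : (n < k)%N -> iter k pqder 'X^n = 0.
Proof.
have der0 : pqder 0 = 0 by apply/polyP => i; rewrite coef_pqder !coef0 mulr0.
elim: k => // k IH; rewrite ltnS leq_eqVlt => /predU1P[<-|/IH /= -> //].
by rewrite iterS iter_pqderXn // subnn pqderZ pqderXn pqnat0 scale0r scaler0.
Qed.

Lemma iter_pqderiv_exp n k :
  iter k (pqderiv p q) (fun y => y ^+ n) = horner (iter k pqder 'X^n).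
Proof.
elim: k => [|k IH] /=; last by rewrite IH pqderiv_horner.
by apply/funext => y; rewrite hornerXn.
Qed.

(** The right-hand side of item 2, the form through which the other items are compared. *)
Definition appell_sum (a : nat -> K) (n : nat) : {poly K} :=
  \sum_(k < n.+1) (pqbinom p q n k * p ^+ 'C(n - k, 2) * a k) *: 'X^(n - k).

Lemma coef_appell_sum a n j : (appell_sum a n)`_j =
  if (j <= n)%N then pqbinom p q n (n - j) * p ^+ 'C(j, 2) * a (n - j)%N else 0.
Proof.
(* Reversing the index makes the exponent the summation variable, so that coefficients can be read
   off. *)
rewrite /appell_sum (reindex_inj rev_ord_inj) /=.
under eq_bigr => i _ do rewrite subSS subKn -1?ltnS //.
pose c j := pqbinom p q n (n - j) * p ^+ 'C(j, 2) * a (n - j)%N.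
by rewrite -(poly_def _ c) coef_poly ltnS.
Qed.

Lemma appell_sum0 a : appell_sum a 0 = (a 0)%:P.
Proof.
rewrite /appell_sum big_ord1 /pqbinom pqfact0 mulr1 divff ?oner_neq0 //.
by rewrite expr0 !mul1r alg_polyC.
Qed.

(** Compare coefficients of x^j; the factor p^j comes from the argument px. *)
Lemma pqAppellP (f : nat -> {poly K}) : pqAppell p q f <->
  forall n j, pqnat p q j.+1 * (f n.+1)`_j.+1 =
              pqnat p q n.+1 * (p ^+ j * (f n)`_j).
Proof.
split=> [fA n j|fA n x].
  rewrite -coef_pqder -coef_comp_scaleX -coefZ; congr ((_ : {poly K})`_j).
  apply: poly_ext => x.
  by rewrite -pqderiv_horner fA hornerZ horner_comp !hornerE.
rewrite pqderiv_horner.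
have -> : pqder (f n.+1) = pqnat p q n.+1 *: (f n \Po (p *: 'X)).
  by apply/polyP => j; rewrite coef_pqder fA coefZ coef_comp_scaleX.
by rewrite hornerZ horner_comp !hornerE.
Qed.

Lemma pqAppell_appell_sum a : pqAppell p q (appell_sum a).
Proof.
apply/pqAppellP => n j; rewrite !coef_appell_sum ltnS subSS.
case: leqP => [le_jn|_]; last by rewrite !mulr0.
(* The factor p^j of the relation comes from C(j+1,2) = C(j,2) + j; the rest is cancellation of
   factorials. *)
rewrite /pqbinom subKn // -subSS subKn // subSS !pqfactS binS bin1 exprD.
by field; rewrite !pqfact_neq0 !pqnat_neq0.
Qed.

(** Since [j+1] is invertible, each member fixes all nonconstant coefficients of the next one; only
    the constant terms are free. *)
Lemma pqAppell_inj (f g : nat -> {poly K}) :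
    pqAppell p q f -> pqAppell p q g ->
    (forall n, (size (f n) <= n.+1)%N) -> (forall n, (size (g n) <= n.+1)%N) ->
  (forall n, (f n)`_0 = (g n)`_0) -> f =1 g.
Proof.
move=> /pqAppellP fA /pqAppellP gA sf sg fg0; elim=> [|n IH]; apply/polyP.
  by case=> [|j]; rewrite ?fg0 // !nth_default // (leq_trans (sf _), leq_trans (sg _)).
case=> [|j]; first exact: fg0.
by apply: (mulfI (pqnat_neq0 j)); rewrite fA gA IH.
Qed.

(** By uniqueness it suffices to match constant terms: in the sum, x^0 occurs only for k = n, with
    coefficient a_n. *)
Lemma pqAppell_eq_appell_sum (f : nat -> {poly K}) :
    (forall n, (size (f n) <= n.+1)%N) -> pqAppell p q f ->
  f =1 appell_sum (fun n => (f n)`_0).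
Proof.
move=> sf fA; apply: pqAppell_inj => //; first exact: pqAppell_appell_sum.
  by move=> n; apply/leq_sizeP => j; rewrite coef_appell_sum ltnNge => /negbTE ->.
move=> n; rewrite coef_appell_sum /= subn0 /pqbinom subnn pqfact0 mulr1.
by rewrite divff ?pqfact_neq0 // expr0 !mul1r.
Qed.

(** The product 1/([k]! [n-k]!) in the convolution is the (p,q)-binomial divided by [n]!. *)
Lemma fps_mul_pqexp (a : nat -> K) n :
  fps_mul (pqgen p q (fun k => (a k)%:P)) (fps_xt (pqexp p q)) n =
  pqgen p q (appell_sum a) n.
Proof.
rewrite /fps_mul /pqgen /fps_xt /appell_sum scaler_sumr; apply: eq_bigr => k _.
rewrite -scalerAl -scalerAr mul_polyC !scalerA /pqbinom /pqexp.
by congr (_ *: _); field; rewrite !pqfact_neq0.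
Qed.

Lemma pqderiv_series (a : nat -> K) n x :
  \sum_(k \in [set: nat])
     (a k * p ^ binom2z (n%:Z - k%:Z) / pqfact p q k
        * iter k (pqderiv p q) (fun y : K => y ^+ n) x) =
  (appell_sum a n).[x].
Proof.
(* Indices above n contribute nothing, whatever the power of p there, since D^k x^n = 0. *)
rewrite -(@fsbig_widen _ _ _ _ `I_n.+1) //; last first.
  move=> k [_ /= /negP]; rewrite -leqNgt => lt_nk.
  by rewrite iter_pqderiv_exp iter_pqderXn_eq0 // horner0 mulr0.
rewrite -fsbig_ord /appell_sum horner_sum; apply: eq_bigr => k _.
have le_kn : (k <= n)%N by rewrite -ltnS.
(* For k <= n the integer n - k is a natural number, so [binom2z] is the usual binomial
   coefficient. *)
rewrite iter_pqderiv_exp iter_pqderXn // subzn // binom2z_nat -exprnP.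
rewrite !hornerZ !hornerXn /pqbinom.
by field; rewrite !pqfact_neq0.
Qed.

End PQCalculus.

(** Supplies the nonvanishing of the (p,q)-numbers, on which the divisions by factorials rest. *)
Lemma pqnat_gt0 (K : numFieldType) (p q : K) n :
  0 < q -> q < p -> 0 < pqnat p q n.+1.
Proof.
move=> q0 qp; rewrite divr_gt0 ?subr_gt0 // ltrXn2r //; exact: ltW.
Qed.

Theorem theorem7 (R : realType) (p q : R) (hq : 0 < q) (hqp : q < p)
    (f : nat -> {poly R[i]}) (hf : forall n : nat, size (f n) = n.+1) :
  [<->
    pqAppell p%:C q%:C f;
    exists a : nat -> R[i], a 0%N <> 0 /\
      forall n : nat,
        f n = \sum_(k < n.+1)
          (pqbinom p%:C q%:C n k * p%:C ^+ 'C(n - k, 2) * a k) *: 'X^(n - k);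
    exists a : nat -> R[i], forall n : nat,
      fps_mul (pqgen p%:C q%:C (fun k : nat => (a k)%:P))
              (fps_xt (pqexp p%:C q%:C)) n
      = pqgen p%:C q%:C f n;
    exists a : nat -> R[i], a 0%N <> 0 /\
      forall (n : nat) (x : R[i]),
        (f n).[x] = \sum_(k \in [set: nat])
          (a k * p%:C ^ binom2z (n%:Z - k%:Z) / pqfact p%:C q%:C k
             * iter k (pqderiv p%:C q%:C) (fun y : R[i] => y ^+ n) x)
  ].
Proof.
have q0 : 0 < q%:C by rewrite ltcR.
have qp : q%:C < p%:C by rewrite ltcR.
have pNq : p%:C != q%:C by rewrite gt_eqF.
have nat0 n : pqnat p%:C q%:C n.+1 != 0 by rewrite gt_eqF // pqnat_gt0.
(* Item 3 does not state that a_0 is nonzero; this is recovered from the exact degree, f_0 being the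
   constant a_0 and of size 1. *)
have a0 a : f 0%N = appell_sum _ p%:C q%:C a 0 -> a 0%N <> 0.
  by move=> fa a00; have := hf 0%N; rewrite fa appell_sum0 a00 size_poly0.
tfae.
- move=> fA; exists (fun n => (f n)`_0).
  have fE : f =1 appell_sum _ p%:C q%:C (fun n => (f n)`_0).
    by apply: pqAppell_eq_appell_sum => // n; rewrite hf.
  by split; [exact: (a0 _ (fE 0%N)) | exact: fE].
- move=> [a [_ fE]]; exists a => n.
  by rewrite fps_mul_pqexp // /pqgen fE.
- move=> [a fE]; exists a.
  have {}fE n : f n = appell_sum _ p%:C q%:C a n.
    apply: (scalerI (invr_neq0 (pqfact_neq0 _ _ _ nat0 n))).
    by have := fE n; rewrite fps_mul_pqexp.
  by split=> [|n x]; [exact: (a0 _ (fE 0%N)) | rewrite pqderiv_series // fE].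
- move=> [a [_ fE]]; have -> : f = appell_sum _ p%:C q%:C a.
    apply/funext => n; apply: poly_ext => x.
    by rewrite fE pqderiv_series.
  exact: pqAppell_appell_sum.
Qed.
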